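(* Let $m \geq 1$ be an integer, let $\lambda_0 \geq 0 > \lambda_1 \geq \lambda_2 \geq \lambda_3$ be real numbers and let $z_1, \ldots, z_m$ be complex numbers with $z_j = a_j + b_j i$, $a_j \in \mathbb{R}$, $b_j > 0$ for $j = 1, \ldots, m$. If $\lambda_0 + \sum_{j=1}^3 \lambda_j - 2\sum_{j=1}^m |z_j| \geq 0$, then there is a $(2m+4) \times (2m+4)$ normal centrosymmetric nonnegative matrix with eigenvalues $\lambda_0, \lambda_1, \lambda_2, \lambda_3, z_1, \ldots, z_m, \overline{z}_1, \ldots, \overline{z}_m$.
   Context: $J$ denotes the reverse identity matrix of the appropriate size (ones on the anti-diagonal, zeros elsewhere). A square matrix $Q$ is centrosymmetric if $JQJ = Q$, nonnegative if all entries are nonnegative, and normal if $QQ^* = Q^*Q$. *)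

(* Defs.v *)
From HB Require Import structures.
From mathcomp Require Import all_boot all_order all_algebra.
From mathcomp Require Import complex.
From mathcomp Require Import reals.
Set Implicit Arguments. Unset Strict Implicit. Unset Printing Implicit Defensive.
Import Order.TTheory GRing.Theory Num.Theory.
Local Open Scope ring_scope.

Definition revI (T : pzRingType) (n : nat) : 'M[T]_n :=
  \matrix_(i < n, j < n) ((i + j == n.-1)%N)%:R.

Definition centrosymmetric (T : pzRingType) (n : nat) (Q : 'M[T]_n) : Prop :=
  revI T n *m Q *m revI T n = Q.

Definition nonneg_mx (R : numDomainType) (n : nat) (Q : 'M[R]_n) : Prop :=
  forall i j, 0 <= Q i j.

Definition conjT (R : rcfType) (n : nat) (A : 'M[R[i]]_n) : 'M[R[i]]_n :=
  (map_mx (@conjc R) A)^T.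

Definition normal_mx (R : rcfType) (n : nat) (A : 'M[R[i]]_n) : Prop :=
  A *m conjT A = conjT A *m A.

Definition complexify (R : rcfType) (n : nat) (Q : 'M[R]_n) : 'M[R[i]]_n :=
  map_mx (fun x => (x%:C)%C) Q.

Definition has_eigenvalues (F : fieldType) (n : nat) (A : 'M[F]_n) (s : seq F) : Prop :=
  char_poly A = \prod_(x <- s) ('X - x%:P).

(* Main.v *)
Require Import Defs.
From HB Require Import structures.
From mathcomp Require Import all_boot all_order all_algebra.
From mathcomp Require Import all_solvable all_field.
From mathcomp Require Import complex.
From mathcomp Require Import reals.
From mathcomp Require Import zify ring lra.
Import Order.TTheory GRing.Theory Num.Theory.
Local Open Scope ring_scope.

(* The circulant matrix of order 2n = 2m + 2 whose eigenvalues are mu >= 0 on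
   the constant vector, l3 on the alternating vector, and z_j, conj z_j on the
   remaining Fourier vectors is normal, and it is nonnegative as soon as
   mu >= |l3| + 2 sum |z_j|.  It commutes with translation by n, which has no
   fixed point, so ordering Z/2n suitably makes it centrosymmetric.  The matrix
   [[0, -l2], [-l2, 0]] has eigenvalues -l2 and l2; placing it on the first and
   last coordinates and coupling the two Perron vectors as in Fiedler's lemma
   trades the eigenvalues -l2 and mu = l0 + l1 + l2 for l0 and l1.  The coupled
   eigenvectors are the rotations (c, s) and (-s, c) of the Perron pair, with
   c^2 = (-l2 - l1) / (l0 - l1).  The entries are estimated in the partial
   order of the complex numbers, where 0 <= x entails that x is real. *)

(** * Roots of unity and similarity *)

(** As [n] is invertible, [X^n - 1] is separable; its [n] distinct roots must include a primitive
    one. *)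
Lemma closed_prim_root_exists (C : closedFieldType) (n : nat) :
  n%:R != 0 :> C -> exists z : C, n.-primitive_root z.
Proof.
move=> n_neq0; have n_gt0 : (0 < n)%N by case: n n_neq0; rewrite ?eqxx.
have [r] := closed_field_poly_normal ('X^n - 1 : {poly C}).
rewrite (monicP _) ?monicXnsubC // scale1r => def_r.
suff /hasP[z _ zP] : has n.-primitive_root r by exists z.
apply: has_prim_root => //.
- by apply/allP => z; rewrite -root_prod_XsubC -def_r.
- by rewrite -separable_prod_XsubC -def_r; apply: separable_Xn_sub_1.
- by have := size_prod_XsubC r id; rewrite -def_r size_XnsubC // => -[->].
Qed.

Lemma unity_root_norm (R : numDomainType) (n : nat) (z : R) :
  (0 < n)%N -> z ^+ n = 1 -> `|z| = 1.
Proof.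
move=> n_gt0 zn1; apply/eqP; rewrite -(@pexpr_eq1 _ _ n) //.
by rewrite -normrX zn1 normr1.
Qed.

(** Geometric sum: [z - 1] times it is a multiple of [z ^+ n - 1 = 0]. The exponents start at 1, as
    do the values of [row_pos]. *)
Lemma sum_unity_root (R : idomainType) (n : nat) (z : R) :
  z ^+ n = 1 -> \sum_(1 <= g < n.+1) z ^+ g = if z == 1 then n%:R else 0.
Proof.
move=> zn1; rewrite big_add1 /= big_mkord.
have [->|z_neq1] := eqVneq.
  under eq_bigr do rewrite expr1n.
  by rewrite sumr_const card_ord.
under eq_bigr do rewrite exprS.
rewrite -big_distrr /=; apply/eqP; rewrite mulf_eq0; apply/orP; right.
have /eqP := subrX1 z n; rewrite zn1 subrr eq_sym mulf_eq0 subr_eq0.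
by rewrite (negPf z_neq1).
Qed.

Lemma char_poly_similar (R : comNzRingType) (n : nat) (U V A : 'M[R]_n) :
  V *m U = 1%:M -> char_poly (U *m A *m V) = char_poly A.
Proof.
move=> VU; have UV := mulmx1C VU.
have VU' : map_mx polyC V *m map_mx polyC U = 1%:M
  by rewrite -map_mxM VU map_mx1.
have -> : char_poly (U *m A *m V) =
    \det (map_mx polyC U *m char_poly_mx A *m map_mx polyC V).
  rewrite /char_poly /char_poly_mx mulmxBr mulmxBl -!map_mxM.
  by rewrite -scalemx1 -!scalemxAr mulmx1 -scalemxAl -map_mxM UV map_mx1.
by rewrite !det_mulmx mulrAC -det_mulmx (mulmx1C VU') det1 mul1r.
Qed.

(** * Unitarily diagonalized matrices *)

Section UnitaryDiagonalization.
Variables (C : numClosedFieldType) (n : nat).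

Definition adj (A : 'M[C]_n) : 'M[C]_n := (map_mx Num.conj A)^T.

Lemma adjM (A B : 'M[C]_n) : adj (A *m B) = adj B *m adj A.
Proof. by rewrite /adj map_mxM trmx_mul. Qed.

Lemma adjK : involutive adj.
Proof. by move=> A; apply/matrixP => i j; rewrite !mxE conjCK. Qed.

Lemma unitary_diag_normal (U : 'M[C]_n) (d : 'rV[C]_n) :
  adj U *m U = 1%:M -> let A := U *m diag_mx d *m adj U in
  A *m adj A = adj A *m A.
Proof.
move=> UU A; have adjA : adj A = U *m adj (diag_mx d) *m adj U.
  by rewrite /A !adjM adjK mulmxA.
have adjD : adj (diag_mx d) = diag_mx (map_mx Num.conj d).
  by rewrite /adj map_diag_mx tr_diag_mx.
rewrite adjA /A !mulmxA -[_ *m adj U *m U]mulmxA UU mulmx1.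
rewrite -[_ *m adj U *m U]mulmxA UU mulmx1 adjD.
by rewrite -!mulmxA; congr (_ *m _); rewrite !mulmxA diag_mxC.
Qed.

Lemma unitary_diag_char_poly (U : 'M[C]_n) (d : 'rV[C]_n) :
  adj U *m U = 1%:M ->
  char_poly (U *m diag_mx d *m adj U) = \prod_(i < n) ('X - (d 0 i)%:P).
Proof.
move=> UU; rewrite char_poly_similar // char_poly_trig ?diag_mx_is_trig //.
by apply: eq_bigr => i _; rewrite mxE eqxx.
Qed.

End UnitaryDiagonalization.

Arguments adj {C n} A.

(** * Indexing of eigenvectors and rows *)

Lemma sum_columns (V : nmodType) (m : nat) (F : nat -> V) :
  \sum_(e < 2 * m + 4) F e =
  F 0 + F 1 + F 2 + F 3 + \sum_(j < m) (F (4 + j)%N + F (4 + m + j)%N).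
Proof.
have -> : (2 * m + 4 = 4 + (m + m))%N by lia.
rewrite big_split_ord /= big_split_ord /= !big_ord_recl big_ord0 addr0 !addrA.
by rewrite big_split !addrA.
Qed.

(* The element of Z/2n, n = m + 1, carried by row p, for 0 < p < 2m + 3: the
   second half is listed backwards, so that reversing the rows is translation
   by n. *)
Definition row_pos (m p : nat) : nat :=
  if (p <= m.+1)%N then p else (3 * m + 4 - p)%N.

(** After the two corner rows are split off, [row_pos] is a bijection onto 1, ..., 2n: the identity
    on the first half, a reversal on the second. *)
Lemma sum_rows (V : nmodType) (m : nat) (F H : nat -> V) :
  (forall p, (0 < p < 2 * m + 3)%N -> F p = H (row_pos m p)) ->
  \sum_(p < 2 * m + 4) F p =
  F 0 + F (2 * m + 3)%N + \sum_(1 <= g < (2 * m.+1).+1) H g.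
Proof.
move=> FH; rewrite -(big_mkord xpredT) !addnS addn0 mulnS !addSn add0n.
rewrite big_nat_recr //= big_ltn // addrAC; congr (_ + _).
rewrite (@big_cat_nat _ _ _ m.+2) //=; last by lia.
rewrite [RHS](@big_cat_nat _ _ _ m.+2) //=; last by lia.
congr (_ + _).
  apply: eq_big_nat => p pP; rewrite FH; last by lia.
  by congr H; rewrite /row_pos ifT; lia.
rewrite big_nat_rev /=; apply: eq_big_nat => p pP.
rewrite FH; last by lia.
by congr H; rewrite /row_pos ifF; lia.
Qed.

(* The Fourier frequency of the e-th eigenvector, in the order l0, l1, l2, l3,
   z_j, conj z_j of the spectrum.  The eigenvector for l2 has no Fourier part;
   its value 1 only records that it is antisymmetric under reversal. *)
Definition column_freq (m e : nat) : nat :=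
  if (e < 2)%N then 0%N else if e == 2 then 1%N else if e == 3 then m.+1 else
  if (e < 4 + m)%N then (e - 3)%N else (3 * m + 5 - e)%N.

Lemma column_freq_lt (m e : nat) :
  (e < 2 * m + 4)%N -> (column_freq m e < 2 * m.+1)%N.
Proof. by rewrite /column_freq; do !case: ifP; lia. Qed.

Lemma column_freq_gt0 (m e : nat) :
  (e.+3 < 2 * m + 4)%N -> (0 < column_freq m e.+3)%N.
Proof. by rewrite /column_freq; do !case: ifP; lia. Qed.

Lemma column_freq_eq (m e f : nat) :
  (e.+3 < 2 * m + 4)%N -> (f.+3 < 2 * m + 4)%N ->
  (column_freq m e.+3 == column_freq m f.+3) = (e == f).
Proof. by rewrite /column_freq; do !case: ifP; lia. Qed.

Lemma column_freq_left (m j : nat) : (j < m)%N -> column_freq m (4 + j) = j.+1.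
Proof. by rewrite /column_freq; do !case: ifP; lia. Qed.

Lemma column_freq_right (m j : nat) :
  (j < m)%N -> column_freq m (4 + m + j) = (2 * m.+1 - j.+1)%N.
Proof. by rewrite /column_freq; do !case: ifP; lia. Qed.

(** * The eigenvectors *)

Section Construction.
Variables (C : numClosedFieldType) (m : nat) (l0 l1 l2 l3 : C) (z : 'I_m -> C).
Variables (zeta c s : C).

Let n := m.+1.
Let N := (2 * m + 4)%N.

Hypotheses (zetaP : (2 * n).-primitive_root zeta).
Hypotheses (c_ge0 : 0 <= c) (s_ge0 : 0 <= s) (cs1 : c ^+ 2 + s ^+ 2 = 1).
Hypotheses (l1_le0 : l1 <= 0) (l2_le0 : l2 <= 0) (l3_le0 : l3 <= 0).
Hypotheses (l0_ge0 : 0 <= l0) (l012 : l0 * c ^+ 2 + l1 * s ^+ 2 = - l2).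
Hypothesis sum_ge0 : 0 <= l0 + l1 + l2 + l3 - 2 * \sum_(j < m) `|z j|.

Definition spectrum : seq C :=
  [:: l0; l1; l2; l3] ++ [seq z j | j : 'I_m] ++ [seq (z j)^* | j : 'I_m].

Let corner (p : nat) := (p == 0) || (p == 2 * m + 3)%N.
Let pos := row_pos m.
(* Coordinates of the e-th unit eigenvector [u e] on the symmetric and
   antisymmetric unit vectors of the two corner rows, and on its Fourier vector. *)
Let kx (e : nat) : C := if e == 0 then c else if e == 1 then - s else 0.
Let ky (e : nat) : C := (e == 2)%:R.
Let kf (e : nat) : C :=
  if e == 0 then s else if e == 1 then c else if e == 2 then 0 else 1.
Let freq := column_freq m.
(** Meant for corner rows only: 1 on the first, -1 on the last. *)
Let sgn (p : nat) : C := (-1) ^+ (p != 0).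
Let u (e p : nat) : C :=
  if corner p then (kx e + sgn p * ky e) / sqrtC 2
  else kf e * zeta ^+ (freq e * pos p) / sqrtC (2 * n)%:R.

Let zeta2n : zeta ^+ (2 * n) = 1. Proof. exact: prim_expr_order. Qed.

Let zetan : zeta ^+ n = -1.
Proof.
have /eqP := zeta2n; rewrite mulnC exprM sqrf_eq1 => /orP[|/eqP//].
rewrite -[1](expr0 zeta) (eq_prim_root_expr zetaP) !modn_small //.
by rewrite /n; lia.
Qed.

Let norm_zeta k : `|zeta ^+ k| = 1.
Proof. by rewrite normrX (@unity_root_norm _ (2 * n)) ?expr1n. Qed.

(** On the unit circle the conjugate is the inverse. *)
Let conj_zeta k k' : (2 * n %| k + k')%N -> (zeta ^+ k)^* = zeta ^+ k'.
Proof.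
move=> /dvdnP[a kk']; have nz : zeta ^+ k != 0.
  by rewrite -normr_eq0 norm_zeta oner_eq0.
apply: (mulfI nz); rewrite -normCK norm_zeta expr1n -exprD kk' mulnC exprM.
by rewrite zeta2n expr1n.
Qed.

Let corner0 : corner 0. Proof. by []. Qed.
Let cornerN : corner (2 * m + 3). Proof. by rewrite /corner eqxx orbT. Qed.

Let c_conj : c^* = c. Proof. exact/conj_Creal/ger0_real. Qed.
Let s_conj : s^* = s. Proof. exact/conj_Creal/ger0_real. Qed.
Let kx_conj e : (kx e)^* = kx e.
Proof.
by rewrite /kx; do 2?case: ifP => _; rewrite ?rmorphN ?rmorph0 /= ?s_conj ?c_conj.
Qed.
Let ky_conj e : (ky e)^* = ky e. Proof. by rewrite rmorph_nat. Qed.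
Let kf_conj e : (kf e)^* = kf e.
Proof.
by rewrite /kf; do 3?case: ifP => _; rewrite ?rmorph0 ?rmorph1 /= ?s_conj ?c_conj.
Qed.
Let sgn_conj p : (sgn p)^* = sgn p. Proof. by rewrite /sgn rmorphXn rmorphN1. Qed.
Let sqrt_conj k : (sqrtC k%:R)^* = sqrtC k%:R :> C.
Proof. by apply/conj_Creal/ger0_real; rewrite sqrtC_ge0 ler0n. Qed.

(** * Orthonormality *)

(** On the corners the mixed [kx], [ky] terms cancel, [sgn] being opposite there. The inner rows
    give a geometric sum in [w], a root of unity that equals 1 exactly when the two powers of [zeta]
    agree. *)
Lemma gram (e f : nat) : \sum_(p < N) (u e p)^* * u f p =
  kx e * kx f + ky e * ky f + kf e * kf f * (zeta ^+ freq e == zeta ^+ freq f)%:R.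
Proof.
pose w := (zeta ^+ freq e)^* * zeta ^+ freq f.
pose H g := kf e * kf f / (2 * n)%:R * w ^+ g.
rewrite (@sum_rows _ _ (fun p => (u e p)^* * u f p) H) => [|p pP]; last first.
  have pN : corner p = false by rewrite /corner; clear -pP; lia.
  rewrite /u pN /H /w !rmorphM /= fmorphV /= sqrt_conj kf_conj.
  rewrite -[in RHS](sqrtCK (2 * n)%:R) -exprVn exprMn !(exprM zeta) rmorphXn /=.
  by rewrite /pos; ring.
rewrite /u corner0 cornerN !rmorphM !rmorphD !rmorphM /= fmorphV /= (sqrt_conj 2).
rewrite !kx_conj !ky_conj !sgn_conj /sgn.
rewrite (_ : (2 * m + 3 != 0)%N = true); last by clear; lia.
have -> : \sum_(1 <= g < (2 * n).+1) H g =
   kf e * kf f * (zeta ^+ freq e == zeta ^+ freq f)%:R.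
  rewrite /H -big_distrr /= sum_unity_root; last first.
    rewrite /w exprMn rmorphXn !(exprAC _ (freq _)) -!rmorphXn zeta2n !expr1n.
    by rewrite rmorph1 mulr1.
  have -> : (w == 1) = (zeta ^+ freq e == zeta ^+ freq f).
    have nz : zeta ^+ freq e != 0 by rewrite -normr_eq0 norm_zeta oner_eq0.
    by rewrite -(inj_eq (mulfI nz)) mulrA -normCK norm_zeta expr1n mul1r
      mulr1 eq_sym.
  case: eqP => _; last by rewrite !mulr0.
  by rewrite divfK ?pnatr_eq0 ?mulr1.
congr (_ + _); rewrite /= expr0 expr1.
have h : (sqrtC 2)^-1 * (sqrtC 2)^-1 = 2^-1 :> C by rewrite -expr2 exprVn sqrtCK.
transitivity ((2 * (kx e * kx f) + 2 * (ky e * ky f)) *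
  ((sqrtC 2)^-1 * (sqrtC 2)^-1)).
  by ring.
by rewrite h; field.
Qed.

Lemma orthonormal (e f : nat) : (e < N)%N -> (f < N)%N ->
  \sum_(p < N) (u e p)^* * u f p = (e == f)%:R.
Proof.
move=> eN fN; rewrite gram (eq_prim_root_expr zetaP) !modn_small ?column_freq_lt //.
case: e eN => [|[|[|e]]] eN; case: f fN => [|[|[|f]]] fN;
  rewrite /kx /ky /kf /= ?mulr0 ?mul0r ?mulr1
  ?addr0 ?add0r ?mul1r -?expr2 ?sqrrN //.
- by rewrite (mulrC s); ring.
- by rewrite /freq eq_sym gtn_eqF ?column_freq_gt0 ?mulr0.
- by ring.
- by rewrite addrC.
- by rewrite /freq eq_sym gtn_eqF ?column_freq_gt0 ?mulr0.
- by rewrite /freq gtn_eqF ?column_freq_gt0 ?mulr0.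
- by rewrite /freq gtn_eqF ?column_freq_gt0 ?mulr0.
- by rewrite /freq column_freq_eq.
Qed.

(** * Nonnegativity of the entries *)

Lemma spectrum_nth (j : 'I_m) :
  spectrum`_(4 + j) = z j /\ spectrum`_(4 + m + j) = (z j)^*.
Proof.
have sz (f : 'I_m -> C) : size [seq f j | j : 'I_m] = m by rewrite size_image card_ord.
rewrite /spectrum; split.
  rewrite -[(4 + j)%N]/(j.+4) /= nth_cat sz ltn_ord.
  by rewrite (nth_map j) ?size_enum_ord ?nth_ord_enum.
rewrite -[(4 + m + j)%N]/((m + j).+4) /= nth_cat sz ltnNge leq_addr /= addKn.
by rewrite (nth_map j) ?size_enum_ord ?nth_ord_enum.
Qed.

Let entry (p q : nat) : C := \sum_(e < N) spectrum`_e * (u e p * (u e q)^*).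

Let entryE p q : entry p q =
  l0 * (u 0 p * (u 0 q)^*) + l1 * (u 1 p * (u 1 q)^*) +
  l2 * (u 2 p * (u 2 q)^*) + l3 * (u 3 p * (u 3 q)^*) +
  \sum_(j < m) (z j * (u (4 + j) p * (u (4 + j) q)^*) +
    (z j)^* * (u (4 + m + j) p * (u (4 + m + j) q)^*)).
Proof.
rewrite /entry (sum_columns _ m (fun e => spectrum`_e * (u e p * (u e q)^*))).
congr (_ + _); apply: eq_bigr => j _.
by have [-> ->] := spectrum_nth j.
Qed.

Let u_corner_eq0 e p : (2 < e)%N -> corner p -> u e p = 0.
Proof.
rewrite /u => + ->; case: e => [|[|[|e]]] // _.
by rewrite /kx /ky /= mulr0 addr0 mul0r.
Qed.

Let sgn_mul p q : sgn p * sgn q = 1 \/ sgn p * sgn q = -1.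
Proof.
by rewrite /sgn -signr_addb; case: (_ (+) _); [right | left].
Qed.

Let sqrt_inv_ge0 k : 0 <= (sqrtC k%:R)^-1 :> C.
Proof. by rewrite invr_ge0 sqrtC_ge0 ler0n. Qed.

(** By [l012] the symmetric part contributes [- l2 / 2] and the antisymmetric part [l2 / 2] up to
    sign, so the entry is 0 or [- l2]. *)
Let entry_corner_ge0 p q : corner p -> corner q -> 0 <= entry p q.
Proof.
move=> pc qc; rewrite entryE big1 => [|j _]; last first.
  by rewrite !u_corner_eq0 // ?mul0r ?mulr0 ?addr0 //; clear; lia.
rewrite (u_corner_eq0 3 p) // mul0r mulr0 !addr0 /u pc qc.
rewrite !rmorphM !rmorphD !rmorphM /= fmorphV /= (sqrt_conj 2).
rewrite !kx_conj !ky_conj !sgn_conj /kx /ky /= !mulr0 !addr0 mulr1 mulr1 !add0r.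
have -> : forall x y v : C, l0 * (c / v * (c / v)) + l1 * (- s / v * (- s / v)) +
    l2 * (x / v * (y / v)) = (l0 * c ^+ 2 + l1 * s ^+ 2 + l2 * (x * y)) * (v^-1 ^+ 2).
  by move=> *; ring.
rewrite l012 mulr_ge0 ?exprn_ge0 //.
have [->|->] := sgn_mul p q; first by rewrite mulr1 addNr.
by rewrite mulrN1 addr_ge0 ?oppr_ge0.
Qed.

(** Only eigenvectors 0 and 1 live on both corner and inner rows; their products there are [c * s]
    and [- s * c], up to normalization. *)
Let entry_border p q : corner p -> ~~ corner q ->
  entry p q = (l0 - l1) * (c * s * ((sqrtC 2)^-1 * (sqrtC (2 * n)%:R)^-1)).
Proof.
move=> pc /negPf qc; rewrite entryE big1 => [|j _]; last first.
  by rewrite !(u_corner_eq0 _ p) // ?mul0r ?mulr0 ?addr0 //; clear; lia.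
rewrite (u_corner_eq0 3 p) // mul0r mulr0 !addr0 /u pc qc.
rewrite !rmorphM /= !fmorphV /= sqrt_conj !kf_conj /kf /kx /ky.
rewrite /freq /column_freq /= !mul0n expr0 rmorph1.
by ring.
Qed.

Let entry_conj_border p q : corner p -> ~~ corner q ->
  entry q p = (l0 - l1) * (c * s * ((sqrtC 2)^-1 * (sqrtC (2 * n)%:R)^-1)).
Proof.
move=> pc /negPf qc; rewrite entryE big1 => [|j _]; last first.
  by rewrite !(u_corner_eq0 _ p) // ?rmorph0 ?mulr0 ?addr0 //; clear; lia.
rewrite (u_corner_eq0 3 p) // rmorph0 !mulr0 !addr0 /u pc qc.
rewrite !rmorphM !rmorphD !rmorphM /= !fmorphV /= (sqrt_conj 2).
rewrite !kx_conj !ky_conj !sgn_conj.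
rewrite /kf /kx /ky /freq /column_freq /= !mul0n expr0.
by ring.
Qed.

Let entry_border_ge0 :
  0 <= (l0 - l1) * (c * s * ((sqrtC 2)^-1 * (sqrtC (2 * n)%:R)^-1)).
Proof. by rewrite !mulr_ge0 // subr_ge0 (le_trans l1_le0). Qed.

(** This is the bound of the real part of [- x] by its modulus. *)
Let addC_conj_ge0 (x : C) : 0 <= x + x^* + 2 * `|x|.
Proof.
have -> : x + x^* = 2 * 'Re x by rewrite ReE mulrC divfK ?pnatr_eq0.
rewrite -mulrDr mulr_ge0 // addrC -[X in _ + X]opprK subr_ge0 -raddfN -normrN.
exact: (leif_Re_Creal (- x)).1.
Qed.

(** The entry is that of a circulant matrix; each Fourier term is bounded below separately, and the
    bounds add up to [sum_ge0]. *)
Let entry_inner_ge0 p q : ~~ corner p -> ~~ corner q -> 0 <= entry p q.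
Proof.
move=> /negPf pc /negPf qc.
pose w (j : 'I_m) := z j * (zeta ^+ (j.+1 * pos p) * (zeta ^+ (j.+1 * pos q))^*).
have -> : entry p q = (l0 + l1 + l2
    + l3 * (zeta ^+ (n * pos p) * (zeta ^+ (n * pos q))^*)
    + \sum_(j < m) (w j + (w j)^*)) * (2 * n)%:R^-1.
  have uE e f : u e p * (u f q)^* =
      kf e * kf f * (zeta ^+ (freq e * pos p) * (zeta ^+ (freq f * pos q))^*)
      * (2 * n)%:R^-1.
    rewrite /u pc qc !rmorphM /= fmorphV /= sqrt_conj kf_conj.
    by rewrite -[in RHS](sqrtCK (2 * n)%:R) -exprVn; ring.
  rewrite entryE !uE [in RHS]mulrDl mulr_suml; congr (_ + _).
    rewrite /kf /freq /column_freq /= !mul0n expr0 rmorph1.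
    (* The rotation preserves the trace [l0 + l1], and [l012] gives the other diagonal entry as
       [- l2]. *)
    have -> : l0 + l1 + l2 = l0 * s ^+ 2 + l1 * c ^+ 2.
      have -> : l0 + l1 = (l0 + l1) * (c ^+ 2 + s ^+ 2) by rewrite cs1 mulr1.
      by rewrite -[l2]opprK -l012; ring.
    by ring.
  apply: eq_bigr => j _; rewrite !uE.
  rewrite [freq (4 + j)]column_freq_left //.
  (* The frequencies of [z j] and its conjugate add up to [2 * n], so their terms are conjugate. *)
  have zconj k : (zeta ^+ (j.+1 * k))^* = zeta ^+ (freq (4 + m + j) * k).
    apply: conj_zeta; rewrite -mulnDl dvdn_mulr //.
    rewrite [freq _]column_freq_right // subnKC // /n.
    by case: j => j /=; clear; lia.
  rewrite -(zconj (pos p)) -(zconj (pos q)) /w !rmorphM /= !conjCK.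
  by rewrite /kf /= !mul1r; ring.
rewrite mulr_ge0 ?invr_ge0 ?ler0n //.
apply: le_trans sum_ge0 _.
apply: lerD.
  (* The factor of [l3] is a sign, and [l3 <= 0] is the smaller of the two values. *)
  rewrite lerD2l !(exprM zeta n) zetan rmorphXn rmorphN1 -exprD -signr_odd.
  by case: odd; rewrite ?expr0 ?mulr1 // expr1 mulrN1 (le_trans l3_le0) ?oppr_ge0.
rewrite mulr_sumr -sumrN; apply: ler_sum => j _.
rewrite -subr_ge0 opprK (le_trans (addC_conj_ge0 (w j))) //.
by rewrite /w !normrM norm_conjC !norm_zeta !mulr1.
Qed.

Let entry_ge0 p q : 0 <= entry p q.
Proof.
case pc: (corner p); case qc: (corner q).
- by rewrite entry_corner_ge0.
- by rewrite entry_border ?qc.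
- by rewrite entry_conj_border ?pc.
- by rewrite entry_inner_ge0 ?pc ?qc.
Qed.

(** * Symmetry under reversal *)

(** Reversal translates the inner positions by [n], and [zeta ^+ n = -1]. Each eigenvector is thus
    symmetric or antisymmetric, and its sign cancels in the products forming [entry]. *)
Let u_rev e p : (p < N)%N -> u e (2 * m + 3 - p) = (-1) ^+ freq e * u e p.
Proof.
move=> pN; rewrite /u.
have -> : corner (2 * m + 3 - p) = corner p.
  by move: pN; rewrite /corner /N; clear; lia.
case: ifP => [pc|pc].
  have -> : sgn (2 * m + 3 - p) = - sgn p.
    case/orP: pc => /eqP ->; rewrite /sgn ?subn0 ?subnn eqxx /= ?expr0.
      by rewrite (_ : (_ != 0)%N = true) ?expr1 //; clear; lia.
    by rewrite (_ : (_ != 0)%N = true) ?expr1 ?opprK //; clear; lia.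
  rewrite mulrA; congr (_ / _); case: e => [|[|[|e]]];
    rewrite /kx /ky /freq /column_freq /=.
  - by rewrite expr0; ring.
  - by rewrite expr0; ring.
  - by rewrite expr1; ring.
  - by rewrite !mulr0 addr0 mulr0.
have -> : zeta ^+ (freq e * pos (2 * m + 3 - p)) =
    (-1) ^+ freq e * zeta ^+ (freq e * pos p).
  rewrite ![(freq e * _)%N]mulnC !(exprM zeta) -exprMn; congr (_ ^+ _).
  rewrite -zetan -exprD; apply/eqP; rewrite (eq_prim_root_expr zetaP).
  move: pN pc; rewrite /N /corner /pos /row_pos /n; clear => pN pc.
  have [le_p|lt_p] := leqP p m.+1.
    by rewrite ifF; [apply/eqP; congr (_ %% _)%N | ]; lia.
  rewrite ifT; last by lia.
  have -> : (m.+1 + (3 * m + 4 - p) = 2 * m.+1 + (2 * m + 3 - p))%N by lia.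
  by rewrite modnDl.
by rewrite mulrCA !mulrA.
Qed.

Let entry_rev p q : (p < N)%N -> (q < N)%N ->
  entry (2 * m + 3 - p) (2 * m + 3 - q) = entry p q.
Proof.
move=> pN qN; apply: eq_bigr => e _; rewrite !u_rev // rmorphM rmorphXn rmorphN1 /=.
by rewrite mulrACA -exprMn mulrNN mulr1 expr1n mul1r.
Qed.

Lemma nonneg_centrosymmetric_realization : exists A : 'M[C]_N,
  [/\ A *m adj A = adj A *m A,
      forall i j, A (rev_ord i) (rev_ord j) = A i j,
      forall i j, 0 <= A i j &
      char_poly A = \prod_(x <- spectrum) ('X - x%:P)].
Proof.
pose U : 'M[C]_N := \matrix_(p, e) u e p.
pose d : 'rV[C]_N := \row_e spectrum`_e.
have UU : adj U *m U = 1%:M.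
  apply/matrixP => e f; rewrite !mxE -orthonormal ?ltn_ord //.
  by apply: eq_bigr => p _; rewrite !mxE.
have AE p q : (U *m diag_mx d *m adj U) p q = entry p q.
  rewrite mxE; apply: eq_bigr => k _.
  by rewrite mul_mx_diag !mxE mulrAC mulrC.
exists (U *m diag_mx d *m adj U); split.
- exact: unitary_diag_normal.
- move=> p q; rewrite !AE -[RHS]entry_rev //=.
  by congr entry; rewrite /N; clear; lia.
- by move=> p q; rewrite AE.
rewrite unitary_diag_char_poly // (big_nth 0) big_mkord.
have -> : size spectrum = N.
  by rewrite /spectrum !size_cat !size_image card_ord /= /N; clear; lia.
by apply: eq_bigr => e _; rewrite mxE.
Qed.

End Construction.

(** * Descent to a real matrix *)

Lemma revI_conj (T : pzRingType) (n : nat) (Q : 'M[T]_n) (i j : 'I_n) :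
  (revI T n *m Q *m revI T n) i j = Q (rev_ord i) (rev_ord j).
Proof.
have rev_eq (h k : 'I_n) : (h + k == n.-1)%N = (k == rev_ord h).
  by rewrite -val_eqE /=; move: (ltn_ord h) (ltn_ord k); lia.
rewrite mxE (bigD1 (rev_ord j)) //= big1 => [|k kj]; last first.
  by rewrite mxE [X in _ * X]mxE addnC rev_eq (negPf kj) mulr0.
rewrite [revI _ _ _ _]mxE addnC rev_eq eqxx mulr1 addr0.
rewrite mxE (bigD1 (rev_ord i)) //= big1 => [|k ki]; last first.
  by rewrite mxE rev_eq (negPf ki) mul0r.
by rewrite mxE rev_eq eqxx mul1r addr0.
Qed.

Theorem theorem3p14 (R : realType) (m : nat) (l0 l1 l2 l3 : R)
    (a b : 'I_m -> R) :
  (1 <= m)%N ->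
  0 <= l0 -> l1 < 0 -> l2 <= l1 -> l3 <= l2 ->
  (forall j, 0 < b j) ->
  0 <= ((l0 + l1 + l2 + l3)%:C - 2 * \sum_(j < m) `|Complex (a j) (b j)|)%C ->
  exists Q : 'M[R]_(2 * m + 4),
    [/\ normal_mx (complexify Q), centrosymmetric Q, nonneg_mx Q &
        has_eigenvalues (complexify Q)
          ([:: (l0%:C)%C; (l1%:C)%C; (l2%:C)%C; (l3%:C)%C]
           ++ [seq Complex (a j) (b j) | j : 'I_m]
           ++ [seq conjc (Complex (a j) (b j)) | j : 'I_m])].
Proof.
move=> _ l0_ge0 l1_lt0 l2_le1 l3_le2 _ sum_ge0.
have l2_lt0 := le_lt_trans l2_le1 l1_lt0.
have l3_lt0 := le_lt_trans l3_le2 l2_lt0.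
(* Drop the moduli from [sum_ge0], then the negative [l1] and [l3]. *)
have l02_ge0 : 0 <= l0 + l2.
  have : 0 <= l0 + l1 + l2 + l3.
    by rewrite -lecR (le_trans sum_ge0) // gerBl mulr_ge0 // sumr_ge0.
  by move=> l_ge0; lra.
have l01_gt0 : 0 < l0 - l1 by lra.
(* The squares of [c] and [s]: the solution of [x + y = 1] and [l0 * x + l1 * y = - l2]. *)
pose x := (- l2 - l1) / (l0 - l1); pose y := (l0 + l2) / (l0 - l1).
have x_ge0 : 0 <= x by rewrite divr_ge0 ?ltW //; lra.
have y_ge0 : 0 <= y by rewrite divr_ge0 // ltW.
have xy1 : x + y = 1 by rewrite /x /y; field; lra.
have lxy : l0 * x + l1 * y = - l2 by rewrite /x /y; field; lra.
have [zeta zetaP] : exists zeta : R[i], (2 * m.+1).-primitive_root zeta.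
  by apply: closed_prim_root_exists; rewrite pnatr_eq0.
have [] := @nonneg_centrosymmetric_realization _ m (l0%:C)%C (l1%:C)%C (l2%:C)%C
  (l3%:C)%C (fun j => Complex (a j) (b j)) zeta
  (sqrtC (x%:C)%C) (sqrtC (y%:C)%C) zetaP.
all: rewrite ?sqrtCK ?sqrtC_ge0 ?lecR ?(ltW l1_lt0) ?(ltW l2_lt0) ?(ltW l3_lt0) //.
- by rewrite -rmorphD xy1.
- by rewrite -!rmorphM -rmorphD lxy rmorphN.
- by move: sum_ge0; rewrite !rmorphD.
move=> A [A_normal A_rev A_ge0 A_char].
pose Q := map_mx (@complex.Re R) A.
(* Nonnegative entries have zero imaginary part, so taking real parts loses nothing. *)
have QA : complexify Q = A.
  apply/matrixP => i j; rewrite !mxE.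
  by move: (A_ge0 i j); rewrite lecE; case: (A i j) => p q /= /andP[/eqP ->].
exists Q; split.
- by rewrite QA.
- by apply/matrixP => i j; rewrite revI_conj !mxE A_rev.
- by move=> i j; rewrite mxE; move: (A_ge0 i j); rewrite lecE => /andP[].
- by rewrite /has_eigenvalues QA.
Qed.
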